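(* Let $m$ be a positive integer and $G$ a finite group. (1) For $m\ge 2$, $G$ is a K$m$CI-group if and only if $m=2$ and $G=1$. (2) For $m\ge 2$, $G$ is not a K$m$DCI-group. (3) For $m\ge 3$, $G$ is neither a K$m$PCI-group nor a K$m$PDCI-group.
   Context: For a finite group $G$ and subsets $S_{i,j}\subseteq G$ ($1\le i,j\le m$), the $m$-Cayley digraph $\Gamma=\mathrm{Cay}(G,S_{i,j}:1\le i,j\le m)$ has vertex set $\bigcup_{i=1}^m G_i$ with $G_i=\{x_i:x\in G\}$ and arc set $\bigcup_{i,j}\{(x_i,(sx)_j): s\in S_{i,j},x\in G\}$; it is an (undirected) graph iff $S_{j,i}=S_{i,j}^{-1}$ for all $i,j$. Such $\Gamma$ (with $m$ fixed and $G$ fixed, all on the same vertex set) are the $m$-Cayley digraphs (graphs) of $G$. For $m>1$ it is an $m$-PCayley digraph if $S_{i,i}=\emptyset$ for all $i$. $R(g):x_i\mapsto (xg)_i$, $R(G)=\{R(g)\}$, with orbits $\mathcal{G}=\{G_1,\dots,G_m\}$. Let $N$ be the normalizer of $R(G)$ in the symmetric group on the vertex set and $K$ the kernel of the action of $N$ on $\mathcal{G}$. An $m$-Cayley digraph $\Gamma$ of $G$ is K$m$CI if for every $m$-Cayley digraph $\Sigma$ of $G$ isomorphic to $\Gamma$ there is $k\in K$ with $\Gamma^k=\Sigma$. $G$ is a K$m$DCI-group (resp. K$m$CI-group) if every $m$-Cayley digraph (resp. every $m$-Cayley graph) of $G$ is K$m$CI. An $m$-PCayley digraph $\Gamma$ of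 $G$ is K$m$PCI if for every $m$-PCayley digraph $\Sigma$ of $G$ such that some isomorphism $\Gamma\to\Sigma$ maps $\mathcal{G}$ to itself, there is $k\in K$ with $\Gamma^k=\Sigma$. $G$ is a K$m$PDCI-group (resp. K$m$PCI-group) if every $m$-PCayley digraph (resp. every $m$-PCayley graph) of $G$ is K$m$PCI.
   Formalization: m-Cayley digraphs are taken loopless (1 not in S_{i,i}); with loops allowed, part (1) fails for m=2, G=1, since a loop at one vertex cannot be moved to the other by the trivial K. *)

(* Defs.v *)
From HB Require Import structures.
From mathcomp Require Import all_boot all_fingroup.

Set Implicit Arguments.
Unset Strict Implicit.
Unset Printing Implicit Defensive.

Local Open Scope group_scope.

(* The finite group G is (the full group of) a finGroupType gT, and the vertex
   x_i is the pair (i, x), with i ranging over 'I_m instead of {1, ..., m}. *)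
Definition vertex (m : nat) (gT : finGroupType) : finType := ('I_m * gT)%type.

Section MCayley.

Variables (m : nat) (gT : finGroupType).
Local Notation V := (vertex m gT).

(* A digraph on V is given by its set of arcs. *)
Definition Cay (S : 'I_m -> 'I_m -> {set gT}) : {set V * V} :=
  \bigcup_(i : 'I_m) \bigcup_(j : 'I_m)
    [set (((i, x), (j, s * x)) : V * V) | s in S i j, x in [set: gT]].

(* Digraphs have no loops, i.e., 1 is not in S i i. This convention matters: if
   loops were allowed, the trivial group would fail to be a K2CI-group, because
   of the two graphs whose unique arc is a loop. *)
Definition mCayley_digraph (D : {set V * V}) : Prop :=
  exists S : 'I_m -> 'I_m -> {set gT},
    (forall i, 1 \notin S i i) /\ D = Cay S.

Definition mPCayley_digraph (D : {set V * V}) : Prop :=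
  exists S : 'I_m -> 'I_m -> {set gT},
    (forall i, S i i = set0) /\ D = Cay S.

Definition undirected (D : {set V * V}) : Prop :=
  forall u v : V, (u, v) \in D -> (v, u) \in D.

Definition mCayley_graph (D : {set V * V}) : Prop :=
  mCayley_digraph D /\ undirected D.

Definition mPCayley_graph (D : {set V * V}) : Prop :=
  mPCayley_digraph D /\ undirected D.

Definition Rfun (g : gT) (v : V) : V := (v.1, v.2 * g).

Lemma Rfun_inj (g : gT) : injective (Rfun g).
Proof. by move=> [i x] [j y] [-> /mulIg ->]. Qed.

Definition Rperm (g : gT) : {perm V} := perm (@Rfun_inj g).

Definition RG : {set {perm V}} := [set Rperm g | g : gT].

Definition part (i : 'I_m) : {set V} := [set v : V | v.1 == i].

Definition parts : {set {set V}} := [set part i | i : 'I_m].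

Definition normR : {set {perm V}} := 'N(RG).

(* The kernel of the action of N on the set of parts is the pointwise stabiliser
   of this set for the action of permutations on subsets of V. *)
Definition kerN : {set {perm V}} := 'C_normR(parts | 'P^*).

Definition digraph_act (D : {set V * V}) (f : {perm V}) : {set V * V} :=
  [set (f a.1, f a.2) | a in D].

Definition KmCI (D : {set V * V}) : Prop :=
  forall E : {set V * V}, mCayley_digraph E ->
    (exists f : {perm V}, digraph_act D f = E) ->
    exists2 k : {perm V}, k \in kerN & digraph_act D k = E.

Definition KmPCI (D : {set V * V}) : Prop :=
  forall E : {set V * V}, mPCayley_digraph E ->
    (exists f : {perm V},
       digraph_act D f = E /\ [set f @: (B : {set V}) | B in parts] = parts) ->
    exists2 k : {perm V}, k \in kerN & digraph_act D k = E.

Lemma in_Cay (S : 'I_m -> 'I_m -> {set gT}) (u v : V) :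
  ((u, v) \in Cay S) = (v.2 * u.2^-1 \in S u.1 v.1).
Proof.
case: u v => i x [j y] /=; apply/bigcupP/idP => [[i' _ /bigcupP[j' _]] | Sxy].
  by case/imset2P=> s z Ss _ [-> -> -> ->]; rewrite mulgK.
exists i => //; apply/bigcupP; exists j => //.
by apply/imset2P; exists (y * x^-1) x; rewrite ?inE ?mulgKV.
Qed.

Lemma undirected_Cay (S : 'I_m -> 'I_m -> {set gT}) :
  undirected (Cay S) <-> forall i j, S j i = (S i j)^-1.
Proof.
have fwd (i j : 'I_m) : undirected (Cay S) -> S i j \subset (S j i)^-1.
  move=> uS; apply/subsetP=> s Ss; rewrite inE.
  have := uS (i, 1) (j, s); rewrite !in_Cay /= invg1 mulg1 mul1g.
  by apply.
split=> [uS i j | uS u v].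
  apply/eqP; rewrite eqEsubset fwd //=.
  by rewrite -(invgK (S j i)) invSg fwd.
by rewrite !in_Cay uS inE invMg invgK.
Qed.

Lemma orbit_RG : [set orbit 'P RG v | v in [set: V]] = parts.
Proof.
have orbE (i : 'I_m) (x : gT) : orbit 'P RG ((i, x) : V) = part i.
  apply/setP=> -[j y]; rewrite inE /=; apply/imsetP/eqP => [[_ /imsetP[g _ ->]] | ->].
    by rewrite /= apermE permE => -[->].
  by exists (Rperm (x^-1 * y)); rewrite ?imset_f //= apermE permE /Rfun /= mulKVg.
apply/setP=> B; apply/imsetP/imsetP => [[[i x] _ ->] | [i _ ->]].
  by exists i; rewrite ?orbE.
by exists (i, 1); rewrite ?orbE ?inE.
Qed.

End MCayley.

Definition KmDCI_group (m : nat) (gT : finGroupType) : Prop :=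
  forall D : {set vertex m gT * vertex m gT}, mCayley_digraph D -> KmCI D.

Definition KmCI_group (m : nat) (gT : finGroupType) : Prop :=
  forall D : {set vertex m gT * vertex m gT}, mCayley_graph D -> KmCI D.

Definition KmPDCI_group (m : nat) (gT : finGroupType) : Prop :=
  forall D : {set vertex m gT * vertex m gT}, mPCayley_digraph D -> KmPCI D.

Definition KmPCI_group (m : nat) (gT : finGroupType) : Prop :=
  forall D : {set vertex m gT * vertex m gT}, mPCayley_graph D -> KmPCI D.

(* Main.v *)
Require Import Defs.
From mathcomp Require Import all_boot all_fingroup.

Set Implicit Arguments.
Unset Strict Implicit.
Unset Printing Implicit Defensive.

(** Elements of [kerN] fix every part, so they preserve the set of pairs [(i, j)]
    for which there is an arc from part [i] to part [j]. Permuting the parts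
    always gives an isomorphic m-Cayley digraph, so any digraph whose pattern of
    nonempty [S i j] is not invariant under all permutations of the indices is a
    counterexample. The only surviving case is that of two vertices, where an
    undirected loopless graph is determined by its number of arcs. *)

Section PartPermutation.

Local Open Scope group_scope.

Variables (m : nat) (gT : finGroupType).
Local Notation V := (vertex m gT).
Implicit Types (S : 'I_m -> 'I_m -> {set gT}) (p : {perm 'I_m})
  (a b c i j : 'I_m).

Definition part_perm_fun p (v : V) : V := (p v.1, v.2).

Lemma part_perm_fun_inj p : injective (part_perm_fun p).
Proof. by move=> [i x] [j y] [/perm_inj -> ->]. Qed.

Definition part_perm p : {perm V} := perm (@part_perm_fun_inj p).

Lemma part_permE p (v : V) : part_perm p v = (p v.1, v.2).
Proof. by rewrite permE. Qed.

Lemma part_perm_Cay S p :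
  digraph_act (Cay (fun i j => S (p i) (p j))) (part_perm p) = Cay S.
Proof.
apply/setP=> -[[i x] [j y]]; apply/imsetP/idP => [[[u v]] | Sxy].
  by rewrite in_Cay /= !part_permE => Suv [-> -> -> ->]; rewrite in_Cay.
exists ((p^-1 i, x), (p^-1 j, y)); last by rewrite /= !part_permE /= !permKV.
by rewrite in_Cay /= !permKV -[_ \in _](in_Cay S (i, x) (j, y)).
Qed.

Lemma part_perm_part p i : part_perm p @: part gT i = part gT (p i).
Proof.
apply/setP=> -[j x]; rewrite inE /=; apply/imsetP/eqP => [[u] | ->].
  by rewrite inE part_permE => /eqP -> [-> _].
by exists (i, x); rewrite ?inE ?part_permE.
Qed.

(** [KmPCI] only admits isomorphisms that map the set of parts to itself; this makes [part_perm p]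
    one of them. *)
Lemma part_perm_parts p :
  [set part_perm p @: (B : {set V}) | B in parts m gT] = parts m gT.
Proof.
apply/setP=> B; apply/imsetP/imsetP => [[_ /imsetP[i _ ->] ->] | [i _ ->]].
  by exists (p i); rewrite ?part_perm_part.
by exists (part gT (p^-1 i)); rewrite ?imset_f // part_perm_part permKV.
Qed.

Lemma kerN_fst (k : {perm V}) (v : V) : k \in kerN m gT -> (k v).1 = v.1.
Proof.
case/setIP=> _ /setIP[_]; rewrite inE => /subsetP kfix.
have /kfix : part gT v.1 \in parts m gT by apply: imset_f.
rewrite inE => /eqP kv; apply/eqP.
have : k v \in part gT v.1 by rewrite -{1}kv; apply/imsetP; exists v; rewrite ?inE.
by rewrite inE.
Qed.

Lemma kerN_Cay_neq0 S T (k : {perm V}) i j :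
  k \in kerN m gT -> digraph_act (Cay S) k = Cay T ->
  S i j != set0 -> T i j != set0.
Proof.
move=> kK SkT /set0Pn[s Ss]; apply/set0Pn.
(* The element [s] gives an arc from part [i] to part [j]; its image under [k] still runs between
   these two parts. *)
have : (k (i, 1), k (j, s)) \in Cay T.
  rewrite -SkT; apply/imsetP; exists ((i, 1), (j, s)) => //.
  by rewrite in_Cay /= invg1 mulg1.
by rewrite in_Cay !kerN_fst //=; exists ((k (j, s)).2 * (k (i, 1)).2^-1).
Qed.

(** The map [part_perm p] is an isomorphism onto [Cay S], but no element of [kerN] is one: the first
    digraph has arcs from part [i] to part [j], the second has none. *)
Lemma not_KmCI_part_perm S p i j :
  (forall i, 1 \notin S i i) -> S (p i) (p j) != set0 -> S i j = set0 ->
  ~ KmCI (Cay (fun i j => S (p i) (p j))).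
Proof.
move=> S1 Sp S0 /(_ (Cay S)) [||k kK kE]; first by exists S.
  by exists (part_perm p); apply: part_perm_Cay.
by move: (kerN_Cay_neq0 kK kE Sp); rewrite S0 eqxx.
Qed.

Lemma not_KmPCI_part_perm S p i j :
  (forall i, S i i = set0) -> S (p i) (p j) != set0 -> S i j = set0 ->
  ~ KmPCI (Cay (fun i j => S (p i) (p j))).
Proof.
move=> S1 Sp S0 /(_ (Cay S)) [||k kK kE]; first by exists S.
  by exists (part_perm p); rewrite part_perm_Cay part_perm_parts.
by move: (kerN_Cay_neq0 kK kE Sp); rewrite S0 eqxx.
Qed.

(** The whole group as connection set is nonempty and closed under inversion for every [gT], so only
    the indices matter. *)
Definition arc_conn (a b i j : 'I_m) : {set gT} :=
  if (i == a) && (j == b) then [set: gT] else set0.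

(** For [a != b], the complete bipartite graph between parts [a] and [b]. *)
Definition edge_conn (a b i j : 'I_m) : {set gT} :=
  arc_conn a b i j :|: arc_conn b a i j.

(** The complete graph on part [a]; removing 1 excludes loops. *)
Definition clique_conn (a i j : 'I_m) : {set gT} := arc_conn a a i j :\ 1.

Lemma arc_conn_id a b : arc_conn a b a b = [set: gT].
Proof. by rewrite /arc_conn !eqxx. Qed.

Lemma arc_conn_diag a b i : a != b -> arc_conn a b i i = set0.
Proof. by rewrite /arc_conn; case: (eqVneq i a) => [-> /negPf->|]. Qed.

Lemma edge_conn_diag a b i : a != b -> edge_conn a b i i = set0.
Proof. by move=> ab; rewrite /edge_conn !arc_conn_diag ?setU0 // eq_sym. Qed.

Lemma setT_neq0 : [set: gT] != set0.
Proof. by apply/set0Pn; exists 1. Qed.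

Lemma arc_conn_inv a b i j : (arc_conn a b i j)^-1 = arc_conn b a j i.
Proof.
by rewrite /arc_conn andbC; case: ifP => _; apply/setP=> x; rewrite !inE.
Qed.

Lemma undirected_edge_conn a b p :
  undirected (Cay (fun i j => edge_conn a b (p i) (p j))).
Proof.
apply/undirected_Cay => i j.
by rewrite /edge_conn invUg !arc_conn_inv setUC.
Qed.

Lemma undirected_clique_conn a p :
  undirected (Cay (fun i j => clique_conn a (p i) (p j))).
Proof.
apply/undirected_Cay => i j; apply/setP=> x.
by rewrite /clique_conn inE -arc_conn_inv !inE invg_eq1.
Qed.

(** All arcs from [b] to [a] versus all arcs from [a] to [b]: swapping the two parts reverses the
    direction. *)
Lemma not_KmDCI_group a b : a != b -> ~ KmDCI_group m gT.
Proof.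
move=> ab KmDCI.
have diag i : 1 \notin arc_conn a b i i by rewrite arc_conn_diag ?inE.
apply: (@not_KmCI_part_perm (arc_conn a b) (tperm a b) b a) => //.
- by rewrite tpermL tpermR arc_conn_id setT_neq0.
- by rewrite /arc_conn eq_sym (negPf ab).
by apply: KmDCI; eexists; split; last reflexivity; move=> i /=.
Qed.

Section ThreeParts.

Variables a b c : 'I_m.
Hypotheses (ab : a != b) (ac : a != c) (bc : b != c).

(** The complete bipartite graph between parts [a] and [c], to be compared with the one between [a]
    and [b]. *)
Let D := Cay (fun i j => edge_conn a b (tperm b c i) (tperm b c j)).

Lemma edge_conn_off : edge_conn a b a c = set0.
Proof.
by rewrite /edge_conn /arc_conn eqxx (negPf ab) eq_sym (negPf bc) setU0.
Qed.

Lemma edge_conn_tperm : edge_conn a b (tperm b c a) (tperm b c c) != set0.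
Proof.
rewrite tpermR tpermD; try by rewrite eq_sym.
by rewrite /edge_conn arc_conn_id setTU setT_neq0.
Qed.

Lemma not_KmCI_edge : ~ KmCI D.
Proof.
apply: not_KmCI_part_perm edge_conn_tperm edge_conn_off => i.
by rewrite edge_conn_diag ?inE.
Qed.

Lemma not_KmPCI_edge : ~ KmPCI D.
Proof.
apply: not_KmPCI_part_perm edge_conn_tperm edge_conn_off => i.
exact: edge_conn_diag.
Qed.

Lemma mPCayley_graph_edge : mPCayley_graph D.
Proof.
split; last exact: undirected_edge_conn.
by eexists; split; last reflexivity; move=> i; apply: edge_conn_diag.
Qed.

Lemma mCayley_graph_edge : mCayley_graph D.
Proof.
split; last exact: undirected_edge_conn.
by eexists; split; last reflexivity; move=> i /=; rewrite edge_conn_diag ?inE.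
Qed.

Lemma not_KmCI_group_three : ~ KmCI_group m gT.
Proof. by move/(_ _ mCayley_graph_edge)/not_KmCI_edge. Qed.

Lemma not_KmPCI_group_three : ~ KmPCI_group m gT.
Proof. by move/(_ _ mPCayley_graph_edge)/not_KmPCI_edge. Qed.

Lemma not_KmPDCI_group_three : ~ KmPDCI_group m gT.
Proof. by move/(_ _ (proj1 mPCayley_graph_edge))/not_KmPCI_edge. Qed.

End ThreeParts.

(** A nontrivial group gives cliques with at least one edge, and the clique on part [b] can be moved
    to part [a] only by moving parts. *)
Lemma KmCI_group_trivial a b : a != b -> KmCI_group m gT -> [set: gT] = 1.
Proof.
move=> ab KmCI; apply/eqP; apply/idPn => ntG.
have diag i : 1 \notin clique_conn a i i by rewrite !inE eqxx.
apply: (@not_KmCI_part_perm (clique_conn a) (tperm a b) b b) => //.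
- rewrite tpermR /clique_conn arc_conn_id; apply: contraNneq ntG => G1.
  by rewrite eqEsubset sub1set inE andbT -setD_eq0 G1.
- by rewrite /clique_conn /arc_conn eq_sym (negPf ab) set0D.
apply: KmCI; split; last exact: undirected_clique_conn.
by eexists; split; last reflexivity; move=> i /=.
Qed.

Lemma mCayley_loopless (D : {set V * V}) (v : V) :
  mCayley_digraph D -> (v, v) \notin D.
Proof. by case=> S [S1 ->]; rewrite in_Cay mulgV. Qed.

Lemma digraph_act1 (D : {set V * V}) : digraph_act D 1 = D.
Proof.
rewrite /digraph_act -[RHS]imset_id; apply: eq_imset => -[u v] /=.
by rewrite !perm1.
Qed.

Lemma card_digraph_act (D : {set V * V}) f : #|digraph_act D f| = #|D|.
Proof.
by apply: card_imset => -[u v] [u' v'] /= [/perm_inj -> /perm_inj ->].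
Qed.

Lemma group1_kerN : 1 \in kerN m gT.
Proof. by rewrite /kerN /normR in_setI !group1. Qed.

Lemma KmCI_group_two_vertices : #|V| = 2 -> KmCI_group m gT.
Proof.
move=> V2 D [Dcay Dsym] _ _ [f <-].
exists 1; first exact: group1_kerN.
rewrite digraph_act1; apply/esym/eqP.
(* Both arc sets have the same size, so one inclusion suffices. *)
rewrite eqEcard card_digraph_act leqnn andbT.
apply/subsetP=> _ /imsetP[[u v] Duv ->] /=.
have neq_uv : u != v.
  by apply: contraTneq Duv => ->; apply: mCayley_loopless.
have uvT : [set u; v] = [set: V].
  by apply/eqP; rewrite eqEcard subsetT cardsT V2 cards2 neq_uv.
have := neq_uv; rewrite -(inj_eq (@perm_inj _ f)).
have : f u \in [set u; v] by rewrite uvT inE.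
have : f v \in [set u; v] by rewrite uvT inE.
(* By injectivity [f] fixes or swaps [u] and [v]; the swapped arc lies in [D] by symmetry. *)
by case/set2P=> -> /set2P[] ->; rewrite ?eqxx //; move=> _; apply: Dsym.
Qed.

End PartPermutation.

Theorem theorem1p6 (m : nat) (hm : 0 < m) (gT : finGroupType) :
  [/\ 2 <= m -> (KmCI_group m gT <-> m = 2 /\ [set: gT] = 1%g),
      2 <= m -> ~ KmDCI_group m gT
    & 3 <= m -> ~ KmPCI_group m gT /\ ~ KmPDCI_group m gT].
Proof.
split=> [m_ge2 | m_ge2 | m_ge3].
- split=> [KmCI | [m2 G1]].
    split; last first.
      (* Since [2 <= m] is [1 < m], the bounds [hm], [m_ge2] and later [m_ge3] yield the indices 0,
         1 and 2, which are distinct by computation. *)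
      exact: (@KmCI_group_trivial _ _ (Ordinal hm) (Ordinal m_ge2)).
    apply/eqP; rewrite eqn_leq m_ge2 andbT leqNgt; apply/negP => m_ge3.
    exact: (@not_KmCI_group_three _ _
             (Ordinal hm) (Ordinal m_ge2) (Ordinal m_ge3)) KmCI.
  apply: KmCI_group_two_vertices.
  by rewrite card_prod card_ord -cardsT G1 cards1 m2.
- exact: (@not_KmDCI_group _ _ (Ordinal hm) (Ordinal m_ge2)).
have m_ge2 := ltnW m_ge3.
split; first exact: (@not_KmPCI_group_three _ _
                      (Ordinal hm) (Ordinal m_ge2) (Ordinal m_ge3)).
exact: (@not_KmPDCI_group_three _ _
         (Ordinal hm) (Ordinal m_ge2) (Ordinal m_ge3)).
Qed.
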